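(* Let $(X,\circ)$ be a group, $Y\leq X$ a subgroup, and $\eta^{z_{ij}}:X\to\mathrm{Sym}(X)$ a reversible $p$-affine structure. Define, for all $a,b\in X$ and $z_i,z_j\in Y$, the binary operation $a+_{ij}b:=a\circ\eta_a^{z_{ij}}(b)$ on $X$. Then the triple $(X,+_{ij},\circ)$ is a $p$-brace. In addition, the maps defined by $$\sigma_a^{z_{ij}}(b):=(\eta_a^{z_{ij}})^{-1}(b)\quad\text{and}\quad\tau_b^{z_{ij}}(a):=\sigma_a^{z_{ij}}(b)^{-1}\circ a\circ b,$$ for all $a,b\in X$ and $z_i,z_j\in Y$, determine a reversible solution $R^{z_{ij}}(b,a)=\big(\sigma_a^{z_{ij}}(b),\tau_b^{z_{ij}}(a)\big)$ on $X$.
   Context: Notation: $0$ is the identity of the group $(X,\circ)$, $a^{-1}$ the inverse in $(X,\circ)$, $z_0:=0$. A superscript $z_{ij}$ or subscript $ij$ denotes dependence on the ordered pair $(z_i,z_j)\in Y\times Y$; $z_{i,jk}$ (or $i,jk$) denotes dependence on $(z_i,z_j\circ z_k)$, $ij,k$ dependence on $(z_i\circ z_j,z_k)$; a subscript $0$ stands for $z_0=0$. A family $\eta^{z_{ij}}:X\to\mathrm{Sym}(X)$, $a\mapsto\eta_a^{z_{ij}}$ ($z_i,z_j\in Y$), is a reversible $p$-affine structure on $(X,\circ)$ if for all $a,b\in X$, $z_i,z_j,z_k\in Y$: $\eta^{z_{i,jk}}_{a\circ b}=\eta_b^{z_{ij}}\eta_a^{z_{ik}}=\eta^{z_{i,kj}}_{a\circ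 b}$ and $a\circ\eta_a^{z_{ij}}(b)=b\circ\eta_b^{z_{ji}}(a)$. $(X,+_{ij},\circ)$, with $+_{ij}$ a binary operation on $X$ for all $z_i,z_j\in Y$, is a $p$-brace if for all $a,b,c\in X$, $z_i,z_j,z_k\in Y$: (1) $(a+_{ij}b)+_{k,ij}c=a+_{ki,j}(b+_{ki}c)$; (2) $a+_{i,kj}b=a+_{i,jk}b=b+_{jk,i}a$; (3) $a=0+_{i0}a$; (4) there is a unique $x\in X$ with $a+_{ij}x=0$; and $a\circ(b+_{k,ij}c)=a\circ b+_{ki}a\circ(a^{-1}+_{kj}c)$. $R^{z_{ij}}$ is a solution if it satisfies the parametric Yang-Baxter equation $R_{12}^{z_{12}}R_{13}^{z_{13}}R_{23}^{z_{23}}=R_{23}^{z_{23}}R_{13}^{z_{13}}R_{12}^{z_{12}}$ on $X^3$ for all $z_1,z_2,z_3\in Y$, where $R_{mn}$ acts as $R$ on the $m$-th and $n$-th components. It is reversible if $R_{21}^{z_{21}}R_{12}^{z_{12}}=\mathrm{id}_{X\times X}$ for all $z_1,z_2\in Y$, where $R_{21}=\pi R\pi$, $\pi(x,y)=(y,x)$. *)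

(* Defs.v *)
From mathcomp Require Import all_boot.
From mathcomp Require Import classical_sets functions.

Set Implicit Arguments.
Unset Strict Implicit.
Unset Printing Implicit Defensive.

Local Open Scope group_scope.

(* The group (X, o) is written multiplicatively: a o b is [a * b], the
   identity 0 is [1].  A subgroup Y <= X is a [subGroupType P], so the
   parameters z_i range over [Y], z_i o z_j is [zi * zj] and z_0 is [1 : Y].
   The pair (z_i, z_j o z_k) abbreviated "i,jk" is passed as [zi (zj * zk)]. *)

(* Sym(X), for a possibly infinite X; [f^-1] is the inverse permutation. *)
Definition Sym (X : Type) := {splitbij [set: X]%classic >-> [set: X]%classic}.

(* Products in Sym(X) are compositions, the right factor acting first. *)
Record reversible_p_affine (X : groupType) (P : {pred X}) (Y : subGroupType P)
    (eta : Y -> Y -> X -> Sym X) : Prop := {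
  p_affineM : forall (a b : X) (zi zj zk : Y),
    eta zi (zj * zk) (a * b) =1 eta zi zj b \o eta zi zk a;
  p_affineMC : forall (a b : X) (zi zj zk : Y),
    eta zi zj b \o eta zi zk a =1 eta zi (zk * zj) (a * b);
  p_affine_rev : forall (a b : X) (zi zj : Y),
    a * eta zi zj a b = b * eta zj zi b a
}.

(* [add zi zj a b] is a +_{ij} b. *)
Record p_brace (X : groupType) (P : {pred X}) (Y : subGroupType P)
    (add : Y -> Y -> X -> X -> X) : Prop := {
  p_braceA : forall (a b c : X) (zi zj zk : Y),
    add zk (zi * zj) (add zi zj a b) c = add (zk * zi) zj a (add zk zi b c);
  p_braceMC : forall (a b : X) (zi zj zk : Y),
    add zi (zk * zj) a b = add zi (zj * zk) a b;
  p_braceC : forall (a b : X) (zi zj zk : Y),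
    add zi (zj * zk) a b = add (zj * zk) zi b a;
  p_brace0 : forall (a : X) (zi : Y), a = add zi 1 1 a;
  p_braceN : forall (a : X) (zi zj : Y), exists! x : X, add zi zj a x = 1;
  p_braceD : forall (a b c : X) (zi zj zk : Y),
    a * add zk (zi * zj) b c =
    add zk zi (a * b) (a * add zk zj a^-1 c)
}.

Definition twist (X : Type) (p : X * X) : X * X := (p.2, p.1).

Definition R12 (X : Type) (r : X * X -> X * X) (t : X * X * X) : X * X * X :=
  let: (x, y, z) := t in let: (u, v) := r (x, y) in (u, v, z).

Definition R13 (X : Type) (r : X * X -> X * X) (t : X * X * X) : X * X * X :=
  let: (x, y, z) := t in let: (u, v) := r (x, z) in (u, y, v).

Definition R23 (X : Type) (r : X * X -> X * X) (t : X * X * X) : X * X * X :=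
  let: (x, y, z) := t in let: (u, v) := r (y, z) in (x, u, v).

Definition R21 (X : Type) (r : X * X -> X * X) : X * X -> X * X :=
  @twist X \o r \o @twist X.

(* The parametric set-theoretic Yang-Baxter equation. *)
Definition solution (X Y : Type) (R : Y -> Y -> X * X -> X * X) : Prop :=
  forall z1 z2 z3 : Y,
    R12 (R z1 z2) \o R13 (R z1 z3) \o R23 (R z2 z3) =1
    R23 (R z2 z3) \o R13 (R z1 z3) \o R12 (R z1 z2).

Definition reversible (X Y : Type) (R : Y -> Y -> X * X -> X * X) : Prop :=
  forall z1 z2 : Y, R21 (R z2 z1) \o R z1 z2 =1 id.

Definition eta_add (X : groupType) (P : {pred X}) (Y : subGroupType P)
    (eta : Y -> Y -> X -> Sym X) (zi zj : Y) (a b : X) : X :=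
  a * eta zi zj a b.

(* [sigma eta zi zj a b] is sigma_a^{z_ij}(b). *)
Definition sigma (X : groupType) (P : {pred X}) (Y : subGroupType P)
    (eta : Y -> Y -> X -> Sym X) (zi zj : Y) (a b : X) : X :=
  ((eta zi zj a)^-1)%FUN b.

(* [tau eta zi zj b a] is tau_b^{z_ij}(a). *)
Definition tau (X : groupType) (P : {pred X}) (Y : subGroupType P)
    (eta : Y -> Y -> X -> Sym X) (zi zj : Y) (b a : X) : X :=
  (sigma eta zi zj a b)^-1 * a * b.

(* The argument pair is (b, a), in this order. *)
Definition etaR (X : groupType) (P : {pred X}) (Y : subGroupType P)
    (eta : Y -> Y -> X -> Sym X) (zi zj : Y) (p : X * X) : X * X :=
  let: (b, a) := p in (sigma eta zi zj a b, tau eta zi zj b a).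

(* Main.v *)
(* The reversibility axiom says that a +_{ij} b = b +_{ji} a.  Combined with the
   multiplicativity of eta it makes eta satisfy the parametric "cycle set"
   identity [eta_cycle].  Moreover R^{z_ij} sends (eta_a^{ij}(u), a) to
   (u, eta_u^{ji}(a)), so substituting the inputs along this parametrization
   turns both sides of the Yang-Baxter equation into iterated values of eta,
   equal by one instance of the identity in each component. *)
Require Import Defs.
From mathcomp Require Import all_boot.
From mathcomp Require Import classical_sets functions.

Set Implicit Arguments.
Unset Strict Implicit.
Unset Printing Implicit Defensive.

Local Open Scope group_scope.

Lemma sigmaK (X : groupType) (P : {pred X}) (Y : subGroupType P)
    (eta : Y -> Y -> X -> Sym X) (zi zj : Y) (a : X) :
  cancel (sigma eta zi zj a) (eta zi zj a).
Proof. by move=> b; apply: invK; rewrite inE. Qed.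

Lemma etaK (X : groupType) (P : {pred X}) (Y : subGroupType P)
    (eta : Y -> Y -> X -> Sym X) (zi zj : Y) (a : X) :
  cancel (eta zi zj a) (sigma eta zi zj a).
Proof. by move=> b; apply: funK; rewrite inE. Qed.

(** Both sides are $\eta^{i,jk}$ at $a +_{jk} b = b +_{kj} a$, applied to $c$; [etaMC] absorbs the
    order of $z_j, z_k$. *)
Lemma eta_cycle (X : groupType) (P : {pred X}) (Y : subGroupType P)
    (eta : Y -> Y -> X -> Sym X) (eta_affine : reversible_p_affine eta)
    (zi zj zk : Y) (a b c : X) :
  eta zi zj (eta zj zk a b) (eta zi zk a c) =
  eta zi zk (eta zk zj b a) (eta zi zj b c).
Proof.
have [etaM etaMC rev] := eta_affine.
rewrite -[RHS](etaM b _ zi zk zj c) -rev.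
exact: (etaMC a _ zi zj zk c).
Qed.

Lemma eta_add_p_brace (X : groupType) (P : {pred X}) (Y : subGroupType P)
    (eta : Y -> Y -> X -> Sym X) (eta_affine : reversible_p_affine eta) :
  p_brace (eta_add eta).
Proof.
have [etaM etaMC rev] := eta_affine.
have etaC zi zj zk a b : eta zi (zj * zk) a b = eta zi (zk * zj) a b.
  by rewrite -[a]mul1g (etaM 1 a zi zj zk b) [LHS](etaMC 1 a zi zj zk b).
rewrite /eta_add; split=> //.
(* With $u = \eta_b^{ki}(c)$ and $w = \eta_b^{ji}(a)$, the sides become $b \circ (w +_{kj} u)$ and
   $b \circ (u +_{jk} w)$. *)
- move=> a b c zi zj zk.
  rewrite [RHS]rev [in RHS](etaM b _ zj zk zi a) /=.
  rewrite (rev a b zi zj) etaC (etaM b _ zk zj zi c) /=.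
  by rewrite -!mulgA rev.
- by move=> a b zi zj zk; rewrite etaC.
(* $\eta_0^{i0}$ is idempotent and injective, hence the identity. *)
- move=> a zi; rewrite mul1g; apply: (can_inj (etaK eta zi 1 1)).
  by have := etaM 1 1 zi 1 1 a; rewrite !mulg1.
- move=> a zi zj; exists (sigma eta zi zj a a^-1); split.
    by rewrite sigmaK mulgV.
  by move=> x /(canRL (mulKg a)); rewrite mulg1 => <-; rewrite etaK.
- move=> a b c zi zj zk; rewrite mulVKg -mulgA.
  (* Splitting $b = a^{-1} \circ (a \circ b)$ makes $\eta_{a^{-1}}^{kj}(c)$ appear on the left
     too. *)
  by rewrite -[in LHS](mulKg a b) (etaM a^-1 (a * b) zk zi zj c) /= mulKg.
Qed.

Lemma etaR_eta (X : groupType) (P : {pred X}) (Y : subGroupType P)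
    (eta : Y -> Y -> X -> Sym X) (eta_affine : reversible_p_affine eta)
    (zi zj : Y) (a u : X) :
  etaR eta zi zj (eta zi zj a u, a) = (u, eta zj zi u a).
Proof. by rewrite /= /tau etaK -mulgA (p_affine_rev eta_affine) mulKg. Qed.

Lemma etaR_reversible (X : groupType) (P : {pred X}) (Y : subGroupType P)
    (eta : Y -> Y -> X -> Sym X) (eta_affine : reversible_p_affine eta) :
  reversible (etaR eta).
Proof.
move=> z1 z2 [b a]; rewrite -[b](sigmaK eta z1 z2 a) compE.
(* The flipped output $(\eta_u^{21}(a), u)$ again has the form that [etaR_eta] evaluates. *)
by rewrite etaR_eta // /R21 [LHS]/(twist (etaR _ _ _ (_, _))) etaR_eta.
Qed.

Lemma etaR_solution (X : groupType) (P : {pred X}) (Y : subGroupType P)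
    (eta : Y -> Y -> X -> Sym X) (eta_affine : reversible_p_affine eta) :
  solution (etaR eta).
Proof.
have RE := etaR_eta eta_affine; have cycle := eta_cycle eta_affine.
move=> z1 z2 z3 [[x y] z].
(* Now $y = \eta_z^{23}(v)$ and $x = \eta_y^{12}(\eta_z^{13}(w))$. *)
rewrite -[y](sigmaK eta z2 z3 z); set v := sigma eta z2 z3 z y.
rewrite -[x](sigmaK eta z1 z2 (eta z2 z3 z v)).
rewrite -[sigma _ _ _ _ x](sigmaK eta z1 z3 z); set w := sigma eta z1 z3 z _.
have R12E (r : X * X -> X * X) p q t : R12 r (p, q, t) = (r (p, q), t).
  by rewrite /=; case: (r _).
have R13E zi zj p q t : R13 (etaR eta zi zj) (eta zi zj t p, q, t) =
    (p, q, eta zj zi p t) by rewrite /R13 RE.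
have R23E zi zj p q t : R23 (etaR eta zi zj) (p, eta zi zj t q, t) =
    (p, q, eta zj zi q t) by rewrite /R23 RE.
rewrite !compE.
(* The cycle identity rewrites $x$ as $\eta^{13}$ indexed by the new third entry $\eta_v^{32}(z)$,
   as [R13E] requires. *)
rewrite R23E [in LHS](cycle z1 z2 z3 z v w) R13E [LHS]R12E RE.
rewrite R12E RE R13E (cycle z2 z1 z3 z w v) R23E.
by rewrite (cycle z3 z1 z2 v w z).
Qed.

Theorem theorem4p5 (X : groupType) (P : {pred X}) (Y : subGroupType P)
    (eta : Y -> Y -> X -> Sym X) (eta_affine : reversible_p_affine eta) :
  p_brace (eta_add eta) /\ solution (etaR eta) /\ reversible (etaR eta).
Proof.
split; first exact: eta_add_p_brace.
by split; [exact: etaR_solution | exact: etaR_reversible].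
Qed.
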